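(* Let $E$ be a nonempty set and let $(E,\lambda)$ be a convergence space (in the sense of Beattie–Butzmann). Let $E' = \mathrm{Fil}(E)$ be the set of all filters on $E$, let $T:\mathcal{P}(E)\to\mathcal{P}(E')$ be defined by $T(\emptyset)=\emptyset$ and $T(A)=\{\mathcal{F}\in \mathrm{Fil}(E) \mid A\in\mathcal{F}\}$ for $\emptyset\neq A\subseteq E$, and let $$\Xi_\lambda=\{(\mathcal{F},\mathcal{G})\in \mathrm{Fil}(E)\times \mathrm{Fil}(E) \mid \exists\, x\in E:\ \mathcal{F}\in\lambda(x)\ \text{and}\ \mathcal{G}\in\lambda(x)\}.$$ Then $\sigma_\lambda=(E,E',T,\Xi_\lambda)$ is a topological type structure (TTS) on $E$. Furthermore, with $E'=\mathrm{Fil}(E)$ ordered by inclusion $\subseteq$ of filters, $(E,(E',\subseteq),T,\Xi_\lambda)$ is a topological type structure with refinement (TTSR) on $E$.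
   Context: Filters on $E$ are proper: a filter is a nonempty family of nonempty subsets of $E$ closed under supersets and finite intersections. $\mathcal{P}(X)$ denotes the power set of $X$. Convergence space: a convergence structure on $E$ is a map $\lambda:E\to\mathcal{P}(\mathrm{Fil}(E))$ such that for all $x\in E$: (i) $\mathcal{U}_x\in\lambda(x)$, where $\mathcal{U}_x=\{A\subseteq E\mid x\in A\}$ is the filter generated by $\{x\}$; (ii) if $\mathcal{F},\mathcal{G}\in\lambda(x)$ then $\mathcal{F}\cap\mathcal{G}\in\lambda(x)$; (iii) if $\mathcal{F}\in\lambda(x)$, $\mathcal{G}\in\mathrm{Fil}(E)$ and $\mathcal{G}\supseteq\mathcal{F}$, then $\mathcal{G}\in\lambda(x)$. Then $(E,\lambda)$ is called a convergence space. TTS: a topological type structure on a nonempty set $E$ is a quadruplet $\sigma=(E,E',T,\Xi)$, where $E'$ is a nonempty set, $T:\mathcal{P}(E)\to\mathcal{P}(E')$ is a map and $\Xi\subseteq E'\times E'$ is a binary relation (written $x'\,\Xi\,y'$ for $(x',y')\in\Xi$), such that: (TTP1) $\emptyset\neq A\subseteq B\subseteq E$ implies $\emptyset\neq T(A)\subseteq T(B)\subseteq E'$; (TTP2) $T(E)=E'$; (TTS1) for all $x\in E$ and all $x',y'\in T(\{x\})$: $x'\,\Xi\,y'$; (TTS2) for all $x',y'\in E'$: $x'\,\Xi\,y'$ implies $y'\,\Xi\,x'$; (TTS3) for all $x',y'\in E'$: $x'\,\Xi\,y'$ implies $x'\,\Xi\,x'$. TTSR: a topological type structure with refinement is $\sigma=(E,(E',\leq),T,\Xi)$,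 where $\leq$ is a pre-order (reflexive and transitive relation) on $E'$, $(E,E',T,\Xi)$ is a TTS, and in addition: (TTP3) if $A\subseteq E$, $x'\in T(A)$, $y'\in E'$ and $x'\leq y'$, then $y'\in T(A)$; (TTS4) for all $x',y',u',v'\in E'$: if $x'\,\Xi\,y'$, $x'\leq u'$ and $y'\leq v'$, then $u'\,\Xi\,v'$. *)

(* Defs.v *)
From Corelib Require Import Relation_Definitions.
From mathcomp Require Import all_boot.
From mathcomp Require Import boolp classical_sets filter.

Set Implicit Arguments.
Unset Strict Implicit.
Unset Printing Implicit Defensive.

Local Open Scope classical_set_scope.

(* Fil(E) is the library's type [pfilter_on E] of proper filters: containing
   [setT] is the same as being a nonempty family, given closure under
   supersets. *)

Definition principal_pfilter (E : Type) (x : E) : pfilter_on E :=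
  PFilterPack (principal_filter x) (principal_filter_proper x).

Lemma pfilterI_proper (E : Type) (F G : pfilter_on E) :
  ProperFilter ((F : set_system E) `&` (G : set_system E)).
Proof.
split; first by case=> F0 _; exact: (filter_not_empty F F0).
split.
- by split; exact: filterT.
- by move=> P Q [FP GP] [FQ GQ]; split; exact: filterI.
- by move=> P Q PQ [FP GP]; split; [exact: (filterS PQ FP)|exact: (filterS PQ GP)].
Qed.

Definition pfilterI (E : Type) (F G : pfilter_on E) : pfilter_on E :=
  PFilterPack ((F : set_system E) `&` (G : set_system E)) (pfilterI_proper F G).

Definition pfilter_le (E : Type) : relation (pfilter_on E) :=
  fun F G => (F : set_system E) `<=` (G : set_system E).

Record convergence_structure (E : Type) (lambda : E -> set (pfilter_on E)) :
    Prop := {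
  conv_principal : forall x, lambda x (principal_pfilter x) ;
  conv_inter : forall x F G,
    lambda x F -> lambda x G -> lambda x (pfilterI F G) ;
  conv_finer : forall x F G,
    lambda x F -> pfilter_le F G -> lambda x G
}.

(* The ground sets E and E' are types, so T A \subseteq E' holds by typing. *)
Record is_TTS (E E' : Type) (T : set E -> set E') (Xi : relation E') :
    Prop := {
  TTS_nonempty : [set: E] !=set0 ;
  TTS_nonempty' : [set: E'] !=set0 ;
  TTP1 : forall A B : set E,
    A !=set0 -> A `<=` B -> T A !=set0 /\ T A `<=` T B ;
  TTP2 : T [set: E] = [set: E'] ;
  TTS1 : forall (x : E) (x' y' : E'),
    T [set x] x' -> T [set x] y' -> Xi x' y' ;
  TTS2 : forall x' y' : E', Xi x' y' -> Xi y' x' ;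
  TTS3 : forall x' y' : E', Xi x' y' -> Xi x' x'
}.

Record is_TTSR (E E' : Type) (le : relation E') (T : set E -> set E')
    (Xi : relation E') : Prop := {
  TTSR_preorder : Relation_Definitions.preorder E' le ;
  TTSR_TTS : is_TTS T Xi ;
  TTP3 : forall (A : set E) (x' y' : E'), T A x' -> le x' y' -> T A y' ;
  TTS4 : forall x' y' u' v' : E',
    Xi x' y' -> le x' u' -> le y' v' -> Xi u' v'
}.

Definition filter_T (E : Type) (A : set E) : set (pfilter_on E) :=
  if `[< A = set0 >] then set0 else [set F : pfilter_on E | F A].

Definition filter_Xi (E : Type) (lambda : E -> set (pfilter_on E)) :
    relation (pfilter_on E) :=
  fun F G => exists x : E, lambda x F /\ lambda x G.

(* Main.v *)
Require Import Defs.
From mathcomp Require Import all_boot.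
From mathcomp Require Import boolp classical_sets filter.

Local Open Scope classical_set_scope.

(** A proper filter containing the singleton of [x] refines the principal filter of [x], which
    converges to [x]; since convergence passes to finer filters, all of [T [set x]] converges to
    [x], whence TTS1 ([principal_pfilter_le], [filter_TTS]). The same stability under refinement
    gives TTS4. The axioms on [T] express that filters contain the whole set and are closed under
    supersets. *)

(* The case split in [filter_T] is redundant because proper filters omit
   [set0]. *)
Lemma filter_TE (E : Type) (A : set E) :
  @filter_T E A = [set F : pfilter_on E | F A].
Proof.
rewrite /filter_T; case: asboolP => // ->.
by apply/seteqP; split=> F //= F0; exact: (filter_not_empty F F0).
Qed.

Lemma pfilter_le_preorder (E : Type) :
  Relation_Definitions.preorder (pfilter_on E) (@pfilter_le E).
Proof.
split=> [F A //|F G H FG GH A FA].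
exact: GH (FG _ FA).
Qed.

Lemma principal_pfilter_le (E : Type) (x : E) (F : pfilter_on E) :
  F [set x] -> pfilter_le (principal_pfilter x) F.
Proof.
move=> Fx A Ax; apply: filterS Fx => y ->.
exact/principal_filterP.
Qed.

Lemma filter_TTS (E : Type) (lambda : E -> set (pfilter_on E)) :
  [set: E] !=set0 -> convergence_structure lambda ->
  is_TTS (@filter_T E) (filter_Xi lambda).
Proof.
move=> E0 lambdaP; split=> //.
- by have [x _] := E0; exists (principal_pfilter x).
- move=> A B [x Ax] AB; rewrite !filter_TE; split.
    (* Any point of [A] yields a proper filter containing [A]. *)
    by exists (principal_pfilter x); apply/principal_filterP.
  by move=> F; exact: filterS.
- by rewrite filter_TE; apply/seteqP; split=> F //= _; exact: filterT.
(* The common limit is the point [x] itself. *)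
- move=> x F G; rewrite filter_TE => /= Fx Gx; exists x.
  by split; apply: (conv_finer lambdaP (conv_principal lambdaP x));
    exact: principal_pfilter_le.
- by move=> F G [x [xF xG]]; exists x.
- by move=> F G [x [xF xG]]; exists x.
Qed.

Theorem mainTheorem1 (E : Type) (E_nonempty : [set: E] !=set0)
    (lambda : E -> set (pfilter_on E))
    (lambda_conv : convergence_structure lambda) :
  is_TTS (@filter_T E) (filter_Xi lambda) /\
  is_TTSR (@pfilter_le E) (@filter_T E) (filter_Xi lambda).
Proof.
have tts := filter_TTS E lambda E_nonempty lambda_conv.
split=> //; split=> //; first exact: pfilter_le_preorder.
(* Refinement is inclusion, so it carries [F A] to [G A]. *)
- by move=> A F G; rewrite filter_TE /= => FA; exact.
(* A common limit of [F] and [G] is kept by their refinements. *)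
- move=> F G F' G' [x [xF xG]] FF' GG'; exists x.
  by split; [exact: (conv_finer lambda_conv xF)|exact: (conv_finer lambda_conv xG)].
Qed.
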